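(* Let $X$ be a Banach space. If the family of Kalton's interlaced graphs $(([\mathbb{N}]^{k},d_{\mathbb{K}}))_{k\in\mathbb{N}}$ equi-coarse Lipschitz embeds into $X^*$, then $\mathrm{Sz}(X)>\omega$, where $\omega$ denotes the first infinite ordinal.
   Context: Interlaced graphs: $\mathbb{N}=\{1,2,\dots\}$. For $k\in\mathbb{N}$, $[\mathbb{N}]^k$ is the set of all $k$-element subsets of $\mathbb{N}$, written as strictly increasing $k$-tuples. Two distinct $\overline n,\overline m\in[\mathbb{N}]^k$ are adjacent if and only if $n_1\le m_1\le n_2\le m_2\le\dots\le n_k\le m_k$ or $m_1\le n_1\le m_2\le n_2\le\dots\le m_k\le n_k$; $d_{\mathbb{K}}$ is the shortest path metric of this graph. Equi-coarse Lipschitz embedding: a family of metric spaces $(M_i,d_i)_{i\in I}$ equi-coarse Lipschitz embeds into a metric space $(N,d)$ if there are constants $A,B,C,D>0$ and maps $f_i:M_i\to N$ such that $A\,d_i(x,y)-C\le d(f_i(x),f_i(y))\le B\,d_i(x,y)+D$ for all $i\in I$ and $x,y\in M_i$. Szlenk index: for a weak$^*$ compact $K\subset X^*$ and $\varepsilon>0$, let $s_\varepsilon(K)=K\setminus\bigcup\{V\subset X^*: V\text{ weak}^*\text{ open and }\mathrm{diam}(V\cap K)<\varepsilon\}$. Define inductively $s_\varepsilon^0(K)=s_\varepsilon(K)$, $s_\varepsilon^{\xi+1}(K)=s_\varepsilon(s_\varepsilon^\xi(K))$, and $s_\varepsilon^\xi(K)=\bigcap_{\zeta<\xi}s_\varepsilon^\zeta(K)$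 for limit ordinals $\xi$. $\mathrm{Sz}(X,\varepsilon)$ is the least ordinal $\xi$ with $s_\varepsilon^\xi(B_{X^*})=\emptyset$ if it exists, and $\infty$ otherwise, and $\mathrm{Sz}(X)=\sup_{\varepsilon>0}\mathrm{Sz}(X,\varepsilon)$. The symbol $\infty$ is regarded as larger than every ordinal. *)

(* Defs.v *)
From HB Require Import structures.
From mathcomp Require Import all_boot all_order all_algebra.
From mathcomp Require Import all_classical all_reals all_analysis.

Set Implicit Arguments.
Unset Strict Implicit.
Unset Printing Implicit Defensive.

Import Order.TTheory GRing.Theory Num.Theory.
Import numFieldNormedType.Exports.

Local Open Scope classical_set_scope.
Local Open Scope ring_scope.

(* [OSup f] is the least ordinal strictly above all the [f i], so that a tree
   stands for an ordinal; two trees stand for the same ordinal when each is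
   [ole] the other. *)
Inductive Ord : Type := OSup (A : Type) (f : A -> Ord).

Fixpoint ole (a b : Ord) : Prop :=
  match a, b with
  | OSup A f, OSup B g => forall i, exists j, ole (f i) (g j)
  end.

Definition olt (a b : Ord) : Prop :=
  match b with OSup B g => exists j, ole a (g j) end.

Definition ozero : Ord := OSup (fun e : void => match e with end).
Definition osucc (a : Ord) : Ord := OSup (fun _ : unit => a).
Fixpoint onat (n : nat) : Ord :=
  if n is m.+1 then osucc (onat m) else ozero.
Definition omega : Ord := OSup onat.

Definition olimit (a : Ord) : Prop :=
  olt ozero a /\ forall b, olt b a -> olt (osucc b) a.

Definition oidx (a : Ord) : Type := match a with OSup A _ => A end.
Definition osub (a : Ord) : oidx a -> Ord :=
  match a with OSup A f => f end.

(* The least upper bound of a family, obtained by merging its trees. *)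
Definition osup (A : Type) (f : A -> Ord) : Ord :=
  OSup (fun p : {i : A & oidx (f i)} => osub (projT2 p)).

Lemma ole_refl a : ole a a.
Proof. by elim: a => A f IH /= i; exists i. Qed.

Lemma ole_trans b a c : ole a b -> ole b c -> ole a c.
Proof.
elim: a b c => I f IH [J g] [L h] /= ab bc i.
have [j fg] := ab i; have [l gh] := bc j.
by exists l; apply: IH fg gh.
Qed.

Lemma olt_osucc a b : olt a (osucc b) <-> ole a b.
Proof. by split=> [[]//|ab]; exists tt. Qed.

Lemma olt_ole a b : olt a b -> ole a b.
Proof.
elim: a b => I f IH [J g] /= [j]; case E: (g j) => [L h] /= fh i.
by have [l fl] := fh i; exists j; apply: IH; rewrite E /=; exists l.
Qed.

Lemma ole_olt_trans b a c : ole a b -> olt b c -> olt a c.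
Proof. by case: c => J g ab [j bj]; exists j; apply: ole_trans bj. Qed.

Lemma olt_ole_trans b a c : olt a b -> ole b c -> olt a c.
Proof.
case: b c => I f [J g] [i ai] bc; have [j fj] := bc i.
by exists j; apply: ole_trans fj.
Qed.

Lemma olt_irr a : ~ olt a a.
Proof.
elim: a => I f IH [i]; case E: (f i) => [J g] /= /(_ i)[j fij].
by apply: (IH i); rewrite {2}E /=; exists j.
Qed.

Lemma ole_or_olt a b : ole a b \/ olt b a.
Proof.
elim: a b => A f IH b.
have [[i bi]|nlt] := pselect (exists i, ole b (f i)); first by right; exists i.
left; case: b nlt => B g nlt i; apply: contrapT => nlt_i; apply: nlt; exists i.
have Hj j : olt (g j) (f i).
  by have [le|//] := IH i (g j); case: nlt_i; exists j.
case: (f i) Hj => C h Hj j; exact: Hj.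
Qed.

Lemma olt_wf : well_founded olt.
Proof.
suff H a b : ole b a -> Acc olt b by move=> a; apply: H (ole_refl a).
elim: a b => I f IH b ba; constructor=> c cb.
by have [i ci] := olt_ole_trans cb ba; apply: IH ci.
Qed.

Lemma osup_ub A (f : A -> Ord) i : ole (f i) (osup f).
Proof.
rewrite /osup; case E: (f i) => [J g] /= j.
have H (o : Ord) (e : o = OSup g) : exists k : oidx o, osub k = g j.
  by subst o; exists j.
by have [k kE] := H _ E; exists (existT _ i k); rewrite /= kE; apply: ole_refl.
Qed.

Lemma osup_lub A (f : A -> Ord) b : (forall i, ole (f i) b) -> ole (osup f) b.
Proof.
move=> fb; have sub_lt a (k : oidx a) : ole a b -> olt (osub k) b.
  by case: a k b {fb} => C h k [B g] /(_ k).
by case: b fb sub_lt => B g fb sub_lt [i k]; exact: sub_lt (fb i).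
Qed.

(* Ordinals extended with a largest element, [None]. *)
Definition ole_ext (a b : option Ord) : Prop :=
  match a, b with
  | _, None => True
  | None, Some _ => False
  | Some a, Some b => ole a b
  end.

Definition olt_ext (a b : option Ord) : Prop :=
  match a, b with
  | None, _ => False
  | Some _, None => True
  | Some a, Some b => olt a b
  end.

Definition osup_ext (A : Type) (f : A -> option Ord) : option Ord :=
  if pselect (exists i, f i = None) then None
  else Some (osup (fun i => odflt ozero (f i))).

Lemma osup_ext_ub A (f : A -> option Ord) i : ole_ext (f i) (osup_ext f).
Proof.
rewrite /osup_ext; case: pselect => [h0|nN]; first by case: (f i).
case E: (f i) => [a|]; last by case: nN; exists i.
by have := osup_ub (fun i => odflt ozero (f i)) i; rewrite E.
Qed.

Lemma osup_ext_lub A (f : A -> option Ord) b :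
  (forall i, ole_ext (f i) b) -> ole_ext (osup_ext f) b.
Proof.
rewrite /osup_ext => H; case: pselect => [[i fi]|nN].
  by have := H i; rewrite fi.
case: b H => // b H; apply: osup_lub => i.
by have := H i; case E: (f i) => //; case: nN; exists i.
Qed.

Definition is_least (P : Ord -> Prop) (a : Ord) : Prop :=
  P a /\ forall b, P b -> ole a b.

Definition least_ord (P : Ord -> Prop) : option Ord :=
  if pselect (exists a, is_least P a) is left h then Some (projT1 (cid h))
  else None.

Lemma ex_least (P : Ord -> Prop) : (exists a, P a) -> exists a, is_least P a.
Proof.
case=> a; elim/(well_founded_ind olt_wf): a => a IH Pa.
have [[b [Pb ba]]|nb] := pselect (exists b, P b /\ olt b a); first exact: IH Pb.
exists a; split=> // b Pb; have [//|ba] := ole_or_olt a b.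
by case: nb; exists b.
Qed.

Lemma least_ordP (P : Ord -> Prop) :
  match least_ord P with Some a => is_least P a | None => forall a, ~ P a end.
Proof.
rewrite /least_ord; case: pselect => [h|nh]; first by case: (cid h).
by move=> a Pa; apply: nh; apply: ex_least; exists a.
Qed.

Lemma omega_limit : olimit omega.
Proof.
split=> [|b [n bn]]; first by exists 0%N => -[].
by exists n.+1 => -[]; exists tt.
Qed.

Section Iteration.
Context {T : Type} (s : set T -> set T).

(* The three cases are: zero, successor of [f i] for a maximal [f i], and
   limit; see [oiter0], [oiterS] and [oiter_limit]. At zero, [s] is already
   applied once. *)
Fixpoint oiter (K : set T) (a : Ord) : set T :=
  match a with
  | OSup A f =>
    if pselect (inhabited A) then
      if pselect (exists i, forall j, ole (f j) (f i)) is left h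
      then s (oiter K (f (projT1 (cid h))))
      else \bigcap_(i in [set: A]) oiter K (f i)
    else s K
  end.

Lemma oiter0 K : oiter K ozero = s K.
Proof. by rewrite /=; case: pselect => // -[]. Qed.

Lemma oiterS K a : oiter K (osucc a) = s (oiter K a).
Proof.
rewrite /=; case: pselect => [h0|[]]; last exact: inhabits tt.
case: pselect => [//|[]]; exists tt => _; exact: ole_refl.
Qed.

Let R K a := [set x | s K x /\ forall b, olt b a -> s (oiter K b) x].

Let R_decr K a b : ole a b -> R K b `<=` R K a.
Proof.
by move=> ab x [sx Hx]; split=> // c ca; apply: Hx; apply: olt_ole_trans ca ab.
Qed.

Lemma oiterE K a : (forall L, s L `<=` L) ->
  oiter K a = [set x | s K x /\ forall b, olt b a -> s (oiter K b) x].
Proof.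
move=> s_sub; rewrite -/(R K a).
elim/(well_founded_ind olt_wf): a => a IH.
have decr b c : olt b a -> olt c a -> ole b c -> oiter K c `<=` oiter K b.
  by move=> ba ca bc; rewrite (IH _ ba) (IH _ ca); exact: R_decr.
have lt_f : forall i, olt (@osub a i) a.
  by case: (a) => A f i; exists i; exact: ole_refl.
case: a IH decr lt_f => A f IH decr lt_f /=.
case: pselect => [[i0]|nA]; last first.
  apply/seteqP; split=> [x sx|x []//]; split=> // b [i]; case: nA.
  exact: inhabits i.
case: pselect => [h|nI].
  case: (cid h) => i hi /=; apply/seteqP; split=> x; last first.
    by case=> _; apply; exact: lt_f.
  move=> sx; have := s_sub _ _ sx; rewrite (IH _ (lt_f i)) => -[sKx Hx].
  split=> // b ba; have bi : ole b (f i).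
    by case: (ba) => j bj; apply: ole_trans bj (hi j).
  have [ib|bi'] := ole_or_olt (f i) b; last exact: Hx.
  suff -> : oiter K b = oiter K (f i) by [].
  by apply/seteqP; split; apply: decr => //; exact: lt_f.
apply/seteqP; split=> x Hx.
  split=> [|b [i bi]].
    by have := Hx i0 Logic.I; rewrite (IH _ (lt_f i0)) => -[].
  have [j ij] : exists j, olt (f i) (f j).
    apply: contrapT => nj; apply: nI; exists i => j.
    by have [//|ij] := ole_or_olt (f j) (f i); case: nj; exists j.
  have := Hx j Logic.I; rewrite (IH _ (lt_f j)) => -[_]; apply.
  exact: ole_olt_trans bi ij.
move=> i _; rewrite (IH _ (lt_f i)); apply: R_decr Hx.
exact: olt_ole (lt_f i).
Qed.

Lemma oiter_decr K a b : (forall L, s L `<=` L) ->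
  ole a b -> oiter K b `<=` oiter K a.
Proof. by move=> s_sub ab; rewrite !oiterE//; exact: R_decr. Qed.

Lemma oiter_limit K a : (forall L, s L `<=` L) -> olimit a ->
  oiter K a = [set x | forall b, olt b a -> oiter K b x].
Proof.
move=> s_sub [a0 aS]; apply/seteqP; split=> [x xa b /olt_ole ba|x Hx].
  exact: oiter_decr ba _ xa.
rewrite oiterE//; split; first by rewrite -oiter0; exact: Hx.
by move=> b ba; rewrite -oiterS; apply: Hx; exact: aS.
Qed.

(* [Ord] is closed under suprema indexed by [set T], so the iteration is
   eventually constant: there are enough ordinals in [Ord]. *)
Lemma oiter_stationary K : (forall L, s L `<=` L) ->
  exists a, forall b, ole a b -> oiter K b = oiter K a.
Proof.
move=> s_sub; pose rep (S : {S | exists a, oiter K a = S}) : Ord :=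
  projT1 (cid (projT2 S)).
have repK S : oiter K (rep S) = projT1 S by exact: projT2 (cid (projT2 S)).
pose t := OSup rep.
pose a := rep (exist _ (oiter K t) (ex_intro _ t erefl)).
have at_ : oiter K a = oiter K t by rewrite repK.
have lt_at : olt a t by eexists; exact: ole_refl.
have sa : s (oiter K a) = oiter K a.
  apply/seteqP; split; first exact: s_sub.
  by rewrite {1}at_ oiterE// => x [_]; exact.
exists a => b; elim/(well_founded_ind olt_wf): b => b IH ab.
apply/seteqP; split=> [|x xa]; first exact: oiter_decr.
move: (xa); rewrite oiterE// => -[sKx Hx]; rewrite oiterE//; split=> // c cb.
have [ac|ca] := ole_or_olt a c; last exact: Hx.
by rewrite IH// sa.
Qed.

End Iteration.

Section Dual.
Context {R : realType} (X : normedModType R).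

Definition is_dual : {pred (X -> R^o)} :=
  fun f => `[< linear f /\ continuous f >].

Record dual : Type := Dual {
  dual_fun :> X -> R^o;
  dual_funP : dual_fun \in is_dual
}.

End Dual.

Section DualLmodule.
Context {R : realType} {X : normedModType R}.

Let submod : submod_closed (@is_dual R X).
Proof.
split.
  apply/asboolP; split; first by move=> a x y /=; rewrite scaler0 addr0.
  exact: cst_continuous.
move=> a f g /asboolP[lf cf] /asboolP[lg cg]; apply/asboolP; split.
  move=> b x y; rewrite -[LHS]/(a *: f (b *: x + y) + g (b *: x + y)).
  rewrite -[RHS]/(b *: (a *: f x + g x) + (a *: f y + g y)) lf lg.
  by rewrite !scalerDr !scalerA mulrC addrACA.
move=> x; apply: cvgD; last exact: cg.
exact: cvgZ (cvg_cst a) (cf x).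
Qed.

HB.instance Definition _ := GRing.isSubmodClosed.Build R _ (@is_dual R X) submod.
HB.instance Definition _ := [isSub for @dual_fun R X].
HB.instance Definition _ := [Choice of dual X by <:].
HB.instance Definition _ := [SubChoice_isSubLmodule of dual X by <:].
End DualLmodule.

Section DualNorm.
Context {R : realType} {X : normedModType R}.
Implicit Types f g : dual X.

Lemma dual_linear f : linear (f : X -> R^o).
Proof. by case/asboolP: (dual_funP f). Qed.

Lemma dual_continuous f : continuous (f : X -> R^o).
Proof. by case/asboolP: (dual_funP f). Qed.

Lemma dual_eqP f g : (f = g) <-> (f =1 g).
Proof. by split=> [->//|fg]; apply/val_inj/funext. Qed.

Lemma dual_addE f g x : (f + g) x = f x + g x.
Proof. by []. Qed.

Lemma dual_scaleE (a : R) f x : (a *: f) x = a * f x.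
Proof. by []. Qed.

Definition dual_norm f : R := sup [set `|f x| | x in [set x : X | `|x| <= 1]].

Let pack f : {linear X -> R^o} :=
  HB.pack (f : X -> R^o) (GRing.isLinear.Build _ _ _ _ _ (@dual_linear f)).

Lemma dual0 f : f 0 = 0.
Proof. exact: (linear0 (pack f)). Qed.

Lemma dualZ f (a : R) x : f (a *: x) = a * f x.
Proof. exact: (linearZ_LR (pack f)). Qed.

Lemma dual_norm_has_sup f :
  has_sup [set `|f x| | x in [set x : X | `|x| <= 1]].
Proof.
split; first by exists 0, 0; rewrite /= ?normr0 ?ler01// dual0 normr0.
have /bounded_funP /(_ 1)[M HM] :=
  (linear_bounded_continuous (pack f)).2 (@dual_continuous f).
by exists M => _ [x x1 <-]; exact: HM.
Qed.

Lemma dual_norm_ge f x : `|f x| <= dual_norm f * `|x|.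
Proof.
have [->|x0] := eqVneq x 0; first by rewrite dual0 !normr0 mulr0.
have nx : 0 < `|x| by rewrite normr_gt0.
rewrite -ler_pdivrMr//.
have -> : `|f x| / `|x| = `|f (`|x|^-1 *: x)|.
  by rewrite dualZ normrM normfV normr_id mulrC.
apply: (sup_upper_bound (dual_norm_has_sup f)); exists (`|x|^-1 *: x) => //=.
by rewrite normrZ normfV normr_id mulVf// gt_eqF.
Qed.

Lemma dual_norm_le f (c : R) :
  0 <= c -> (forall x, `|f x| <= c * `|x|) -> dual_norm f <= c.
Proof.
move=> c0 H; apply: ge_sup; first exact: (dual_norm_has_sup f).1.
by move=> _ [x /= x1 <-]; apply: le_trans (H x) _; rewrite ler_piMr.
Qed.

Let norm_ge0 f : 0 <= dual_norm f.
Proof.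
apply: (sup_upper_bound (dual_norm_has_sup f)); exists 0.
  by rewrite /= normr0.
by rewrite dual0 normr0.
Qed.

Let normD f g : dual_norm (f + g) <= dual_norm f + dual_norm g.
Proof.
apply: dual_norm_le => [|x]; first exact: addr_ge0.
by rewrite dual_addE (le_trans (ler_normD _ _))// mulrDl lerD// dual_norm_ge.
Qed.

Let normZ_le (a : R) f : dual_norm (a *: f) <= `|a| * dual_norm f.
Proof.
apply: dual_norm_le => [|x]; first exact: mulr_ge0.
by rewrite dual_scaleE normrM -mulrA ler_wpM2l// dual_norm_ge.
Qed.

Let normZ (a : R) f : dual_norm (a *: f) = `|a| * dual_norm f.
Proof.
apply/eqP; rewrite eq_le normZ_le /=.
have [->|a0] := eqVneq a 0; first by rewrite normr0 mul0r.
rewrite -ler_pdivlMl ?normr_gt0// -normfV.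
by apply: le_trans (normZ_le _ _); rewrite scalerA mulVf// scale1r.
Qed.

Let norm_eq0 f : dual_norm f = 0 -> f = 0.
Proof.
move=> f0; apply/dual_eqP => x; apply/normr0_eq0/eqP.
by rewrite eq_le normr_ge0 andbT (le_trans (dual_norm_ge f x))// f0 mul0r.
Qed.

HB.instance Definition _ :=
  Lmodule_isNormed.Build R (dual X) normD normZ norm_eq0.

Let dist_ge0 f g : 0 <= `|f - g|.
Proof. exact: normr_ge0. Qed.

Let dist_eq0 f g : `|f - g| = 0 -> f = g.
Proof. by move/normr0_eq0/eqP; rewrite subr_eq0 => /eqP. Qed.

Let dist_ball f d : ball f d = [set g | `|f - g| < d].
Proof. by rewrite -ball_normE. Qed.

HB.instance Definition _ :=
  @PseudoMetric_isMetric.Build R (dual X) _ dist_ge0 dist_eq0 dist_ball.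

Lemma dual_mdistE f g : mdist f g = `|f - g|.
Proof. by []. Qed.

Lemma dual_normE f : `|f| = dual_norm f.
Proof. by []. Qed.

End DualNorm.

Definition weak_star_open {R : realType} {X : normedModType R}
    (V : set (dual X)) : Prop :=
  @open (initial_topology (fun f : dual X => (f : {ptws X -> R}))) V.

(* [ereal_sup set0 = -oo], hence the maximum with 0. *)
Definition diam {R : realType} {M : metricType R} (A : set M) : \bar R :=
  maxe 0%E (ereal_sup [set (mdist p.1 p.2)%:E | p in A `*` A]).

Definition dual_ball {R : realType} (X : normedModType R) : set (dual X) :=
  [set f | `|f| <= 1].
Arguments dual_ball {R} X.

Section Szlenk.
Context {R : realType} (X : normedModType R).

Definition szlenk_deriv (eps : R) (K : set (dual X)) : set (dual X) :=
  K `\` \bigcup_(V in [set V | weak_star_open V /\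
                               (diam (V `&` K) < eps%:E)%E]) V.

Lemma szlenk_deriv_sub eps K : szlenk_deriv eps K `<=` K.
Proof. by move=> f []. Qed.

Definition Sz_eps (eps : R) : option Ord :=
  least_ord (fun a => oiter (szlenk_deriv eps) (dual_ball X) a = set0).

Definition Sz : option Ord :=
  osup_ext (fun eps : {eps : R | 0 < eps} => Sz_eps (val eps)).

End Szlenk.

Section GraphDistance.
Context {T : eqType} (e : rel T).

Definition walk (x y : T) (n : nat) : Prop :=
  exists p, [/\ path e x p, last x p = y & size p = n].

Hypothesis connected : forall x y, exists n, `[< walk x y n >].

Definition graph_dist (x y : T) : nat := ex_minn (connected x y).

Lemma graph_dist_le x y n : walk x y n -> (graph_dist x y <= n)%N.
Proof.
by rewrite /graph_dist; case: ex_minnP => m _ H w; apply: H; apply/asboolP.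
Qed.

Lemma graph_dist_walk x y : walk x y (graph_dist x y).
Proof. by rewrite /graph_dist; case: ex_minnP => m /asboolP. Qed.

Lemma graph_distxx x : graph_dist x x = 0%N.
Proof. by apply/eqP; rewrite -leqn0; apply: graph_dist_le; exists [::]. Qed.

Lemma graph_dist_eq0 x y : graph_dist x y = 0%N -> x = y.
Proof. by have [p [_ + sp]] := graph_dist_walk x y; rewrite -sp; case: p {sp}. Qed.

Lemma graph_dist_triangle y x z :
  (graph_dist x z <= graph_dist x y + graph_dist y z)%N.
Proof.
have [p [ep lp <-]] := graph_dist_walk x y.
have [q [eq lq <-]] := graph_dist_walk y z.
apply: graph_dist_le; exists (p ++ q).
by rewrite cat_path last_cat size_cat lp ep.
Qed.

Lemma graph_dist_sym : symmetric e -> forall x y, graph_dist x y = graph_dist y x.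
Proof.
move=> es; suff H x y : (graph_dist x y <= graph_dist y x)%N.
  by move=> x y; apply/eqP; rewrite eqn_leq !H.
have [p [ep lp <-]] := graph_dist_walk y x.
apply: graph_dist_le; exists (rev (belast y p)); split.
- rewrite -lp rev_path.
  by under eq_path do rewrite es.
- case: p {ep} lp => [/=->//|a p _]; by rewrite /= rev_cons last_rcons.
- by rewrite size_rev size_belast.
Qed.

End GraphDistance.

(* [:: n_1; m_1; n_2; m_2; ...] *)
Definition interleave (n m : seq nat) : seq nat :=
  flatten [seq [:: p.1; p.2] | p <- zip n m].

Definition interlaced (n m : seq nat) : bool := sorted leq (interleave n m).

Lemma interlacedP (k : nat) (n m : seq nat) : size n = k -> size m = k ->
  reflect ((forall i, (i < k)%N -> (nth 0%N n i <= nth 0%N m i)%N) /\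
           (forall i, (i.+1 < k)%N -> (nth 0%N m i <= nth 0%N n i.+1)%N))
          (interlaced n m).
Proof.
move=> sn sm; apply: (iffP idP); move: n m sn sm; rewrite /interlaced.
  elim: k => [|k IH] [|a n] [|b m] //= [sn] [sm] /andP[ab H].
  have [H1 H2] : (forall i, (i < k)%N -> (nth 0%N n i <= nth 0%N m i)%N) /\
           (forall i, (i.+1 < k)%N -> (nth 0%N m i <= nth 0%N n i.+1)%N).
    apply: IH => //; exact: path_sorted H.
  split=> [[//|i] ik|[|i] ik]; [exact: H1| |exact: H2].
  case: n m sn sm H ik {H1 H2} => [|a' n] [|b' m] //=;
    try by move=> <-.
  by move=> _ _ /andP[].
elim: k => [|k IH] [|a n] [|b m] //= [sn] [sm] [H1 H2].
rewrite (H1 0%N)//=.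
have: sorted leq (interleave n m).
  by apply: IH => //; split=> i ik; [exact: (H1 i.+1)|exact: (H2 i.+1)].
case: n m sn sm H1 H2 => [|a' n] [|b' m] //= sn sm H1 H2.
by rewrite /= => /andP[-> ->]; rewrite (H2 0%N)// -sn.
Qed.

(* The vertices [N]^k, where N starts at 1. *)
Definition is_ksubset (k : nat) : {pred k.-tuple nat} :=
  fun n => sorted ltn n && all (leq 1) n.

(* The scalar field is recorded for the sake of the [metricType R] structure. *)
Record interlaced_graph (R : realType) (k : nat) : Type := Ksubset {
  ktuple :> k.-tuple nat;
  ktupleP : ktuple \in @is_ksubset k
}.

HB.instance Definition _ (R : realType) (k : nat) :=
  [isSub for @ktuple R k].
HB.instance Definition _ (R : realType) (k : nat) :=
  [Choice of interlaced_graph R k by <:].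

Section InterlacedGraph.
Context {R : realType} {k : nat}.
Local Notation V := (interlaced_graph R k).

Definition kalton_adj : rel V :=
  fun n m => (n != m) && (interlaced n m || interlaced m n).

Lemma kalton_adj_sym : symmetric kalton_adj.
Proof. by move=> n m; rewrite /kalton_adj eq_sym orbC. Qed.

Let conn (x y : V) := exists n, walk kalton_adj x y n.

Let conn_trans y x z : conn x y -> conn y z -> conn x z.
Proof.
move=> [_ [p [ep lp _]]] [_ [q [eq lq _]]]; exists (size (p ++ q)), (p ++ q).
by rewrite cat_path last_cat lp ep.
Qed.

Let conn_sym x y : conn x y -> conn y x.
Proof.
move=> [_ [p [ep lp _]]]; exists (size p), (rev (belast x p)); split.
- rewrite -lp rev_path; by under eq_path do rewrite kalton_adj_sym.
- case: p {ep} lp => [/=->//|a p _]; by rewrite /= rev_cons last_rcons.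
- by rewrite size_rev size_belast.
Qed.

Let conn_interlaced (x y : V) : interlaced x y -> conn x y.
Proof.
move=> xy; have [<-|nxy] := eqVneq x y; first by exists 0%N, [::].
by exists 1%N, [:: y]; rewrite /= /kalton_adj nxy xy.
Qed.

Let kgraph_eq (x y : V) :
  (forall i, (i < k)%N -> nth 0%N x i = nth 0%N y i) -> x = y.
Proof.
move=> xy; do 2 apply: val_inj; apply: (@eq_from_nth _ 0%N).
  by rewrite !size_tuple.
by move=> i; rewrite size_tuple; exact: xy.
Qed.

Section Window.
Variable g : nat -> nat.
Hypothesis g_mono : forall i, (g i < g i.+1)%N.
Hypothesis g_gt0 : (0 < g 0)%N.

Let window_subproof j : [tuple g (i + j)%N | i < k] \in @is_ksubset k.
Proof.
have gm : {homo g : a b / (a < b)%N} by apply: homo_ltn => // ? ? ?; exact: ltn_trans.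
rewrite unfold_in /=; apply/andP; split.
  rewrite (_ : map _ _ = [seq g (i + j)%N | i <- iota 0 k]); last first.
    by rewrite -val_enum_ord -map_comp.
  rewrite sorted_map; apply: sub_sorted (iota_ltn_sorted 0 k) => a b ab.
  by rewrite /= gm// ltn_add2r.
apply/allP => _ /mapP[i _ ->]; rewrite /=.
case: (i + j)%N => // l; exact: leq_trans (ltnW (gm 0%N l.+1 _)).
Qed.

Let window j : V := Ksubset R (window_subproof j).

Let nth_window j i : (i < k)%N -> nth 0%N (window j) i = g (i + j)%N.
Proof. by move=> ik; rewrite -(tnth_nth _ _ (Ordinal ik)) tnth_mktuple. Qed.

Lemma window_conn (x : V) : (forall i, (i < k)%N -> nth 0%N x i = g i) ->
  exists2 y : V, (forall i, (i < k)%N -> nth 0%N y i = g (i + k)%N) & conn x y.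
Proof.
move=> xg; exists (window k); first exact: nth_window.
have -> : x = window 0.
  apply: kgraph_eq => i ik; by rewrite nth_window// addn0 xg.
suff H j : conn (window 0) (window j) by exact: H.
elim: j => [|j IH]; first by exists 0%N, [::].
apply: conn_trans IH _; apply: conn_interlaced.
apply/(interlacedP (k := k)); rewrite ?size_tuple//; split=> i ik.
  by rewrite !nth_window// addnS ltnW.
by rewrite !nth_window// ?(ltnW ik)// addnS addSn.
Qed.

End Window.

Let conn_far (x : V) (N : nat) : (forall i, (i < k)%N -> (nth 0%N x i < N)%N) ->
  exists2 y : V, (forall i, (i < k)%N -> nth 0%N y i = (N.+1 + i)%N) & conn x y.
Proof.
move=> xN; pose g l := if (l < k)%N then nth 0%N x l else (N.+1 + (l - k))%N.
have /andP[x_sorted x_gt0] := ktupleP x.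
have g_mono i : (g i < g i.+1)%N.
  rewrite /g; case: (ltnP i.+1 k) => ik1; case: (ltnP i k) => ik.
  - by apply: (sortedP 0%N x_sorted); rewrite size_tuple.
  - by have := leq_trans (ltnW ik1) ik; rewrite ltnn.
  - by apply: leq_trans (xN _ ik) _; rewrite ltnW// addSn ltnS leq_addr.
  - by rewrite ltn_add2l ltn_sub2r// ltnS.
have g_gt0 : (0 < g 0)%N.
  rewrite /g; case: (ltnP 0 k) => // k0; apply: (allP x_gt0 (nth 0%N x 0)).
  by rewrite mem_nth// size_tuple.
have [|y yg xy] := window_conn g_mono g_gt0 (x := x).
  by move=> i ik; rewrite /g ik.
by exists y => // i ik; rewrite yg// /g ltnNge leq_addl addnK.
Qed.

Lemma kalton_connected (x y : V) : exists n, `[< walk kalton_adj x y n >].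
Proof.
pose N := (\max_(i < k) tnth x i + \max_(i < k) tnth y i)%N.+1.
have xN i : (i < k)%N -> (nth 0%N x i < N)%N.
  move=> ik; rewrite ltnS -(tnth_nth _ _ (Ordinal ik)).
  by apply: leq_trans (leq_addr _ _); apply: (leq_bigmax (F := fun i => tnth x i)).
have yN i : (i < k)%N -> (nth 0%N y i < N)%N.
  move=> ik; rewrite ltnS -(tnth_nth _ _ (Ordinal ik)).
  by apply: leq_trans (leq_addl _ _); apply: (leq_bigmax (F := fun i => tnth y i)).
have [x' x'N xx'] := conn_far xN; have [y' y'N yy'] := conn_far yN.
have xy' : x' = y' by apply: kgraph_eq => i ik; rewrite x'N// y'N.
have [n xyn] : conn x y.
  by apply: conn_trans xx' _; rewrite xy'; exact: conn_sym.
by exists n; apply/asboolP.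
Qed.

Definition kalton_dist : V -> V -> nat := graph_dist kalton_connected.

Let dist (x y : V) : R := (kalton_dist x y)%:R.

Let distxx x : dist x x = 0.
Proof. by rewrite /dist /kalton_dist graph_distxx. Qed.

Let dist_eq0 x y : dist x y = 0 -> x = y.
Proof. by move=> /eqP; rewrite pnatr_eq0 => /eqP; exact: graph_dist_eq0. Qed.

Let dist_sym x y : dist x y = dist y x.
Proof. by rewrite /dist /kalton_dist graph_dist_sym//; exact: kalton_adj_sym. Qed.

Let dist_triangle y x z : dist x z <= dist x y + dist y z.
Proof. by rewrite /dist -natrD ler_nat graph_dist_triangle. Qed.

HB.instance Definition _ :=
  @isMetric.Build R V dist distxx dist_eq0 dist_sym dist_triangle.

Lemma kalton_mdistE (x y : V) : mdist x y = (kalton_dist x y)%:R.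
Proof. by []. Qed.

End InterlacedGraph.

Definition equi_coarse_lipschitz_embeds {R : realType} {I : Type}
    (M : I -> metricType R) (N : metricType R) : Prop :=
  exists (A B C D : R) (f : forall i, M i -> N),
    [/\ 0 < A, 0 < B, 0 < C & 0 < D] /\
    forall i (x y : M i),
      A * mdist x y - C <= mdist (f i x) (f i y) <= B * mdist x y + D.

(* Main.v *)
Require Import Defs.
From HB Require Import structures.
From mathcomp Require Import all_boot all_order all_algebra.
From mathcomp Require Import all_classical all_reals all_analysis.
From mathcomp Require Import ring lra.

Set Implicit Arguments.
Unset Strict Implicit.
Unset Printing Implicit Defensive.

Import Order.TTheory GRing.Theory Num.Theory.
Import numFieldNormedType.Exports.

Local Open Scope classical_set_scope.
Local Open Scope ring_scope.

(** The idea is to take iterated weak* limits of an embedding and to read its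
    oscillation as membership in Szlenk derivatives of the dual ball.

    Suppose that Sz(X) <= omega. Every point of the intersection of the finite
    derivatives of the dual ball survives at stage omega, which is empty; so
    for each eps there is an r such that the r-th derivative of the ball does
    not contain 0 ([Sz_le_omega]).

    Let f map the k-subsets of the naturals to X* so that adjacent vertices
    have images at distance at most 1. Any two vertices n < m, all of m lying
    to the right of n, are joined by a path of length k of sliding windows, so
    f is bounded on a tail of the graph ([lipschitz_far]), and weak* limits
    along a free ultrafilter U exist ([wstar_cvg_ex]). Put
      f_j(n_1, .., n_j) = lim_(n_(j+1)) .. lim_(n_k) f(n_1, .., n_k).
    Along a typical branch, f(n) - f_0 is the sum of the increments
    f_j(n_1, .., n_j) - f_(j-1)(n_1, .., n_(j-1)), each of norm at most 1, and
    whether the j-th one has norm at least eps depends on j only, because U is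
    an ultrafilter. Let N be the number of levels j where it does. Then
    |f(n) - f_0| <= k eps + N for a typical n.

    The number N is bounded independently of k. For n_1 < m_1 < n_2 < m_2 < ..
    the vertices n and m are adjacent, so f_j(n_1, .., n_j) - f_j(m_1, .., m_j)
    is a tree in the unit ball, in which each node is the weak* limit of its
    successors. At N of the levels the successors stay eps away from the node,
    which therefore drops one derivative deeper; at the root, f_0 - f_0 = 0
    lies in the N-th derivative of the ball, so N < r ([iter_lim_branch]).

    Hence there are vertices n < m with |f(n) - f(m)| <= 2 (k eps + r)
    ([interlaced_concentration]), although their distance in the graph is at
    least k ([mdist_far]). For eps small this contradicts a linear lower bound
    A k - C as soon as k is large. *)

(** * Interlaced lists *)

Section Interlacing.

Lemma path_ltn_weaken a b s : (a <= b)%N -> path ltn b s -> path ltn a s.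
Proof.
by case: s => //= n s ab /andP[bn ->]; rewrite (leq_ltn_trans ab bn).
Qed.

Lemma interleave_subseq (s t : seq nat) : size s = size t ->
  subseq s (interleave s t) /\ subseq t (interleave s t).
Proof.
elim: s t => [|n s IH] [|m t] // [] /IH[sst tst]; split.
  exact: (cat_subseq (prefix_subseq [:: n] [:: m]) sst).
exact: (cat_subseq (suffix_subseq [:: n] [:: m]) tst).
Qed.

Lemma interlaced_cat (a : nat) (p s t : seq nat) :
  path ltn a (p ++ interleave s t) -> interlaced (p ++ s) (p ++ t).
Proof.
move=> /(sub_path ltnW); rewrite /interlaced.
suff H b : path leq b (p ++ interleave s t) ->
    path leq b (interleave (p ++ s) (p ++ t)).
  by move=> /H/path_sorted.
by elim: p b => //= n p IH b /andP[-> /IH->]; rewrite leqnn.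
Qed.

Lemma path_ltn_cat_interleave (a : nat) (p s t : seq nat) : size s = size t ->
  path ltn a (p ++ interleave s t) ->
  path ltn a (p ++ s) /\ path ltn a (p ++ t).
Proof.
move=> /interleave_subseq[ss st] H; split; apply: (subseq_path ltn_trans) H;
  exact: cat_subseq.
Qed.

End Interlacing.

(** * Distances in the interlaced graphs *)

Section Vertices.
Context {R : realType} {k : nat}.
Local Notation V := (interlaced_graph R k).

Lemma vertex_subproof : [tuple of iota 1 k] \in @is_ksubset k.
Proof.
rewrite unfold_in /= iota_ltn_sorted /=; apply/allP => n.
by rewrite mem_iota => /andP[].
Qed.

Definition vertex0 : V := Ksubset R vertex_subproof.

(** Making the map total, with a default vertex for the lists that enumerate
    none, keeps proofs of validity out of the tree of iterated limits. *)
Definition vertex (s : seq nat) : V :=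
  insubd vertex0 (insubd (val vertex0) s).

Lemma vertexE s : size s = k -> path ltn 0 s -> vertex s = s :> seq nat.
Proof.
move=> sk s0; rewrite /vertex; set u := insubd (val vertex0) s.
have uE : u = s :> seq nat by rewrite /u val_insubd sk eqxx.
rewrite val_insubd ifT ?uE// unfold_in /= uE (path_sorted s0) /=.
exact: order_path_min ltn_trans s0.
Qed.

Lemma mdist_interlaced_le1 (x y : V) : interlaced x y -> mdist x y <= 1.
Proof.
move=> xy; have [->|nxy] := eqVneq x y; first by rewrite mdistxx.
rewrite kalton_mdistE (_ : 1 = 1%:R)// ler_nat; apply: graph_dist_le.
by exists [:: y]; rewrite /= /kalton_adj nxy xy.
Qed.

(** Moving along an edge, an entry can pass at most the next entry of the old
    vertex, in whichever direction the two are interlaced; hence a walk of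
    length d shifts indices by at most d. *)
Lemma kalton_adj_nth (x y : V) i : kalton_adj x y -> (i.+1 < k)%N ->
  (nth 0%N y i <= nth 0%N x i.+1)%N.
Proof.
move=> /andP[_ /orP[] /(interlacedP (size_tuple _) (size_tuple _))[H1 H2] ik].
  exact: H2.
apply: leq_trans (H1 _ (ltnW ik)) _.
have /andP[x_sorted _] := ktupleP x.
by apply/ltnW/(sortedP 0%N x_sorted); rewrite size_tuple.
Qed.

Lemma walk_nth (x y : V) d i : walk kalton_adj x y d -> (i + d < k)%N ->
  (nth 0%N y i <= nth 0%N x (i + d))%N.
Proof.
case=> p [xp <- <-]; elim: p x i xp => [|z p IH] x i /=; first by rewrite addn0.
move=> /andP[xz zp]; rewrite addnS => ik.
apply: leq_trans (IH _ _ zp (ltnW ik)) _; exact: kalton_adj_nth.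
Qed.

(** With fewer than k steps the first entry of the endpoint would still be
    bounded by an entry of the starting vertex. *)
Lemma mdist_far (s t : seq nat) : size s = k -> size t = k ->
  path ltn 0 (s ++ t) -> k%:R <= mdist (vertex s) (vertex t).
Proof.
move=> sk tk st; rewrite kalton_mdistE ler_nat leqNgt; apply/negP => dk.
have := walk_nth (i := 0%N) (graph_dist_walk kalton_connected _ _) dk.
move: dk; rewrite add0n; set d := graph_dist _ _ _ => dk.
have s0 : path ltn 0 s.
  exact: (subseq_path ltn_trans (prefix_subseq s t)) st.
have t0 : path ltn 0 t.
  exact: (subseq_path ltn_trans (suffix_subseq s t)) st.
have k0 : (0 < k)%N := leq_ltn_trans (leq0n _) dk.
rewrite !vertexE// leqNgt; apply/negP/negPn.
have := sorted_ltn_nth ltn_trans 0%N (path_sorted st).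
move=> /(_ d k); rewrite !inE size_cat sk tk !nth_cat sk ltnn subnn dk.
apply=> //.
  by rewrite ltn_addr.
by rewrite -{1}[k]addn0 ltn_add2l.
Qed.

Lemma vertex0E : vertex0 = vertex (iota 1 k).
Proof.
do 2 apply: val_inj; rewrite /= vertexE ?size_iota//.
by case: (k) => //= n; exact: (iota_ltn_sorted 1 n.+1).
Qed.

Lemma mdist_cat_interleave (a : nat) (p s t : seq nat) : size s = size t ->
  (size p + size s)%N = k -> path ltn a (p ++ interleave s t) ->
  mdist (vertex (p ++ s)) (vertex (p ++ t)) <= 1.
Proof.
move=> st pk H; apply: mdist_interlaced_le1.
have [pa1 pa2] := path_ltn_cat_interleave st H.
rewrite !vertexE ?size_cat -?st//; last 2 first.
- exact: path_ltn_weaken (leq0n _) pa2.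
- exact: path_ltn_weaken (leq0n _) pa1.
exact: interlaced_cat H.
Qed.

Lemma mdist_windows (u : seq nat) j : path ltn 0 u -> (j + k < size u)%N ->
  mdist (vertex (take k (drop j u))) (vertex (take k (drop j.+1 u))) <= 1.
Proof.
move=> u0 jk; apply: mdist_interlaced_le1.
have sw i : (i + k <= size u)%N -> size (take k (drop i u)) = k.
  move=> ik; rewrite size_takel// size_drop leq_subRL//.
  exact: leq_trans (leq_addr _ _) ik.
have w0 i : path ltn 0 (take k (drop i u)).
  apply: (subseq_path ltn_trans) u0.
  exact: subseq_trans (take_subseq _ _) (drop_subseq _ _).
rewrite !vertexE ?sw// ?(ltnW jk)//.
apply/(interlacedP (sw _ (ltnW jk)) (sw j.+1 jk)); split=> i ik.
  rewrite !nth_take// !nth_drop addSn.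
  apply/ltnW/(sortedP 0%N (path_sorted u0)).
  by apply: leq_ltn_trans jk; rewrite -addnS leq_add2l.
by rewrite !nth_take ?(ltnW ik)// !nth_drop addSnnS.
Qed.

(** The windows of length k of the list s ++ t are a path of k edges from s
    to t. *)
Lemma lipschitz_far {N : normedZmodType R} (F : V -> N) (L : R)
    (s t : seq nat) :
  (forall x y, mdist x y <= 1 -> `|F x - F y| <= L) ->
  size s = k -> size t = k -> path ltn 0 (s ++ t) ->
  `|F (vertex s) - F (vertex t)| <= k%:R * L.
Proof.
move=> FL sk tk st; pose w j := vertex (take k (drop j (s ++ t))).
suff H j : (j <= k)%N -> `|F (w 0%N) - F (w j)| <= j%:R * L.
  have := H k (leqnn _); rewrite /w drop0 take_size_cat// drop_size_cat//.
  by rewrite take_oversize ?tk.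
elim: j => [|j IH] jk; first by rewrite subrr normr0 mul0r.
rewrite -(subrKA (F (w j))) (le_trans (ler_normD _ _))// -natr1 mulrDl mul1r.
rewrite lerD ?IH ?(ltnW jk)//; apply/FL/mdist_windows => //.
by rewrite size_cat sk tk ltn_add2r.
Qed.

End Vertices.

(** * Ultrafilters *)

Lemma ultra_fmap (S T : Type) (g : S -> T) (U : set_system S) :
  UltraFilter U -> UltraFilter (g @ U).
Proof.
move=> UU; split; first exact: fmap_proper_filter.
move=> G GF UG; apply/seteqP; split=> [A GA|]; last exact: UG.
have [//|UA] := in_ultra_setVsetC (g @^-1` A) UU.
by have /filter_ex[x []//] : G (A `&` ~` A) by apply: filterI GA _; exact: UG.
Qed.

Lemma filter_meets (T : Type) (U : set_system T) (A B : set T) :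
  ProperFilter U -> U A -> U B -> exists x, A x /\ B x.
Proof.
by move=> PU UA UB; exact: (@filter_ex _ U PU (A `&` B) (filterI UA UB)).
Qed.

Lemma ultra_pigeonhole (U : set_system nat) (c : nat -> nat) k :
  UltraFilter U -> (forall n, (c n <= k)%N) ->
  exists N, \forall n \near U, c n = N.
Proof.
move=> UU ck; have {ck} : \forall n \near U, (c n <= k)%N by exact: filterE.
elim: k => [|k IH] ck.
  by exists 0%N; apply: filterS ck => n; rewrite leqn0 => /eqP.
have [ckk|ckN] := in_ultra_setVsetC [set n | c n = k.+1] UU.
  by exists k.+1.
apply: IH; apply: filterS2 ck ckN => n; rewrite leq_eqVlt => /orP[/eqP//|].
by rewrite ltnS.
Qed.

(** * Weak* limits along an ultrafilter *)

Section WeakStar.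
Context {R : realType} {X : normedModType R}.
Implicit Types (U : set_system nat) (h : nat -> dual X) (d : dual X).

Definition wstar_cvg U h d :=
  forall x : X, (fun n => h n x : R^o) @ U --> (d x : R^o).

Lemma wstar_cvg_near U h d (V : set (dual X)) {FU : Filter U} :
  wstar_cvg U h d -> weak_star_open V -> V d -> \forall n \near U, V (h n).
Proof.
move=> hd [Q Qo QV] Vd.
have /pointwise_cvgP : forall x : X,
    (fun g : X -> R => g x) @ ((fun n => h n : X -> R) @ U) --> (d : X -> R) x.
  by move=> x; exact: hd.
move=> /(_ Q) QU; rewrite -QV; apply: QU; apply: open_nbhs_nbhs; split=> //.
by move: Vd; rewrite -QV.
Qed.

Lemma dual_linearE (f : dual X) (a : R) x y : f (a *: x + y) = a * f x + f y.
Proof. exact: dual_linear. Qed.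

Lemma is_dual_bounded (g : X -> R^o) (M : R) : linear g ->
  (forall x, `|g x| <= M * `|x|) -> g \in @is_dual R X.
Proof.
move=> lg gM; apply/asboolP; split=> //.
pose G : {linear X -> R^o} := HB.pack g (GRing.isLinear.Build _ _ _ _ _ lg).
apply: (@bounded_linear_continuous _ _ _ G).
apply/linear_boundedP; near=> r => x; apply: le_trans (gM x) _.
by rewrite ler_wpM2r.
Unshelve. all: by end_near. Qed.

(** Pointwise limits exist because the values at each vector stay in a compact
    interval; their linearity and their bound pass to the limit. *)
Lemma wstar_cvg_ex U h (M : R) : UltraFilter U -> (forall n, `|h n| <= M) ->
  exists d, `|d| <= M /\ wstar_cvg U h d.
Proof.
move=> UU hM.
have hx n x : `|h n x| <= M * `|x|.
  by apply: le_trans (dual_norm_ge _ _) _; apply: ler_wpM2r => //; exact: hM.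
have lim_ex x : exists l : R^o,
    `|l| <= M * `|x| /\ (fun n => h n x : R^o) @ U --> l.
  have := @segment_compact R (- (M * `|x|)) (M * `|x|).
  rewrite compact_ultra => /(_ ((fun n => h n x : R) @ U)) [].
    exact: ultra_fmap.
    by apply: (@filterE _ U) => n; rewrite /= in_itv/= -ler_norml; exact: hx.
  by move=> l [/= + hl]; rewrite in_itv/= -ler_norml => lM; exists l; split.
pose g x := projT1 (cid (lim_ex x)).
have gM x : `|g x| <= M * `|x| by rewrite /g; case: cid => l [].
have gl x : (fun n => h n x : R^o) @ U --> g x.
  by rewrite /g; case: cid => l [].
have lg : linear g.
  move=> a x y.
  apply: (@cvg_unique R^o _ ((fun n => h n (a *: x + y) : R^o) @ U)) => //.
    exact: gl.
  rewrite /= (_ : (fun n => _) = (fun n => a *: (h n x : R^o) + h n y)).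
    by apply: cvgD (gl y); apply: cvgZr (gl x).
  by apply/funext => n; exact: dual_linearE.
exists (Dual (is_dual_bounded lg gM)); split => //.
apply: dual_norm_le => //; apply: le_trans (hM 0%N); exact: normr_ge0.
Qed.

Lemma wstar_cvg_cst U d {FU : Filter U} : wstar_cvg U (fun=> d) d.
Proof. by move=> x; exact: cvg_cst. Qed.

Lemma wstar_cvgB U h h1 d d1 {FU : Filter U} :
  wstar_cvg U h d -> wstar_cvg U h1 d1 ->
  wstar_cvg U (fun n => h n - h1 n) (d - d1).
Proof. by move=> hd hd1 x; exact: cvgB (hd x) (hd1 x). Qed.

Lemma wstar_cvg_norm_le U h d (c : R) {FU : ProperFilter U} :
  0 <= c -> wstar_cvg U h d -> (\forall n \near U, `|h n| <= c) -> `|d| <= c.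
Proof.
move=> c0 hd hc; apply: dual_norm_le => // x.
have cl : closed [set l : R^o | `|l| <= c * `|x|].
  apply: (@closed_comp R^o R^o (fun l => `|l|) [set l | l <= c * `|x|]).
    by move=> l _; exact: norm_continuous.
  exact: closed_le.
apply: (closed_cvg _ cl _ _ (hd x)).
apply: filterS hc => n hn; apply: le_trans (dual_norm_ge _ _) _.
exact: ler_wpM2r.
Qed.

Definition wstar_lim U h : dual X :=
  if pselect (exists d, wstar_cvg U h d) is left e then projT1 (cid e) else 0.

Lemma wstar_limP U h (M : R) : UltraFilter U -> (forall n, `|h n| <= M) ->
  wstar_cvg U h (wstar_lim U h).
Proof.
move=> UU /(wstar_cvg_ex UU)[d [_ hd]]; rewrite /wstar_lim.
by case: pselect => [e|[]]; [case: cid|exists d].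
Qed.

Lemma wstar_lim_le U h (M : R) : UltraFilter U -> (forall n, `|h n| <= M) ->
  `|wstar_lim U h| <= M.
Proof.
move=> UU hM; apply: (wstar_cvg_norm_le _ (wstar_limP UU hM)).
  exact: le_trans (hM 0%N).
exact: filterE.
Qed.

(** * Szlenk derivatives and weak* limits *)

Definition wstar_closed U (K : set (dual X)) :=
  forall h d, wstar_cvg U h d -> (\forall n \near U, K (h n)) -> K d.

(** A derivative removes a weak* open set. *)
Lemma wstar_closed_deriv U eps K {FU : ProperFilter U} :
  wstar_closed U K -> wstar_closed U (szlenk_deriv eps K).
Proof.
move=> cK h d hd Kh; split.
  by apply: cK hd _; apply: filterS Kh => n [].
case=> V [Vo Vd] dV.
have Vh : \forall n \near U, V (h n) by exact: wstar_cvg_near hd Vo dV.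
by have [n [[_ nV] Vn]] := filter_meets FU Kh Vh; apply: nV; exists V.
Qed.

(** Every weak* neighbourhood of the limit contains a point of the sequence
    that is eps away from the limit, so its trace on K has diameter at least
    eps. *)
Lemma szlenk_deriv_lim U eps K h d {FU : ProperFilter U} :
  wstar_closed U K -> wstar_cvg U h d -> (\forall n \near U, K (h n)) ->
  (\forall n \near U, eps <= `|h n - d|) -> szlenk_deriv eps K d.
Proof.
move=> cK hd Kh he; have Kd := cK _ _ hd Kh; split=> // -[V [Vo Veps] Vd].
have Vh : \forall n \near U, V (h n) by exact: wstar_cvg_near hd Vo Vd.
have [n [[Khn hen] Vhn]] := filter_meets FU (@filterI _ U _ _ _ Kh he) Vh.
move: Veps; rewrite ltNge => /negP; apply.
rewrite /diam le_max; apply/orP; right.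
apply: (@le_trans _ _ (`|h n - d|%:E)); first by rewrite lee_fin.
by apply: ereal_sup_ubound; exists (h n, d).
Qed.

(** Unlike in [oiter], stage 0 is the ball itself: it is the natural home of
    the leaves of the trees below. *)
Definition szlenk_iter eps r := iter r (szlenk_deriv eps) (@dual_ball R X).

Lemma wstar_closed_iter U eps r {FU : ProperFilter U} :
  wstar_closed U (szlenk_iter eps r).
Proof.
elim: r => [|r IH]; last exact: wstar_closed_deriv.
by move=> h d hd Bh; exact: wstar_cvg_norm_le hd Bh.
Qed.

Lemma szlenk_iter_sub eps r r' : (r <= r')%N ->
  szlenk_iter eps r' `<=` szlenk_iter eps r.
Proof.
move=> /subnK<-; elim: (r' - r)%N => // n IH.
by rewrite addSn; apply: subset_trans IH; exact: szlenk_deriv_sub.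
Qed.

Lemma szlenk_iter_oiter eps n :
  oiter (szlenk_deriv eps) (@dual_ball R X) (onat n) = szlenk_iter eps n.+1.
Proof.
by elim: n => [|n IH]; [exact: oiter0|rewrite [onat _]/= oiterS IH].
Qed.

(** * Concentration of maps on the interlaced graphs *)

(** The limit in the first entry is the outermost one, so that fixing an initial
    segment of the list gives the partial limits f_j. *)
Fixpoint iter_lim U k (f : seq nat -> dual X) : dual X :=
  if k is k'.+1 then wstar_lim U (fun n => iter_lim U k' (fun s => f (n :: s)))
  else f [::].

Lemma iter_lim_le U k f (M : R) : UltraFilter U -> (forall s, `|f s| <= M) ->
  `|iter_lim U k f| <= M.
Proof.
move=> UU; elim: k f => [f fM|k IH f fM] /=; first exact: fM.
by apply: (wstar_lim_le UU) => n; apply: IH.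
Qed.

Lemma iter_lim_cvg U k f (M : R) : UltraFilter U -> (forall s, `|f s| <= M) ->
  wstar_cvg U (fun n => iter_lim U k (fun s => f (n :: s))) (iter_lim U k.+1 f).
Proof.
by move=> UU fM; apply: (wstar_limP UU) => n; apply: iter_lim_le => // s.
Qed.

(** Fixing different first entries of one function gives two functions, so the
    recursion on k has to compare two functions. The bound [a] leaves room for
    the entries that are already fixed, which are smaller. *)
Definition interlaced_close a k (f f' : seq nat -> dual X) :=
  forall s t, size s = k -> size t = k -> path ltn a (interleave s t) ->
  `|f s - f' t| <= 1.

(** The common prefix makes the condition inherited when the first entry is
    fixed. *)
Definition interlaced_lipschitz a k (f : seq nat -> dual X) := forall p s t,
  size s = size t -> (size p + size s)%N = k ->
  path ltn a (p ++ interleave s t) -> `|f (p ++ s) - f (p ++ t)| <= 1.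

Lemma interlaced_lipschitz_close a k f :
  interlaced_lipschitz a k f -> interlaced_close a k f f.
Proof. by move=> lf s t sk tk; apply: (lf [::]) => //; rewrite sk tk. Qed.

Lemma interlaced_lipschitz_cons a n k f : (a < n)%N ->
  interlaced_lipschitz a k.+1 f ->
  interlaced_lipschitz n k (fun s => f (n :: s)).
Proof.
move=> an lf p s t st pk H; apply: (lf (n :: p)) => //=.
  by rewrite addSn pk.
by rewrite an.
Qed.

Lemma interlaced_close_cons b n m k f f' : (b < n)%N -> (n < m)%N ->
  interlaced_close b k.+1 f f' ->
  interlaced_close m k (fun s => f (n :: s)) (fun s => f' (m :: s)).
Proof.
by move=> bn nm cf s t sk tk H; apply: cf; rewrite /= ?sk ?tk ?bn ?nm.
Qed.

(** Here N counts the levels at which the increments of the tree of partial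
    limits of f have norm at least eps for U-almost all successors. The same N
    has to serve both conclusions: along a suitable branch the increments add up
    to at most k eps + N, and each counted level pushes the differences
    f_j(n_1, .., n_j) - f'_j(m_1, .., m_j) one derivative deeper. In
    the recursion on k, N <= k is what makes the counts of the subtrees agree
    for U-almost all first entries. *)
Lemma iter_lim_branch U (eps : R) k a (f : seq nat -> dual X) (M : R) :
  UltraFilter U -> \oo `<=` U -> 0 <= eps ->
  (forall s, `|f s| <= M) -> interlaced_lipschitz a k f ->
  exists N, [/\ (N <= k)%N,
    (forall b (f' : seq nat -> dual X), (forall s, `|f' s| <= M) ->
       interlaced_close b k f f' ->
       szlenk_iter eps N (iter_lim U k f - iter_lim U k f')) &
    exists s, [/\ size s = k, path ltn a s &
       `|f s - iter_lim U k f| <= k%:R * eps + N%:R]].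
Proof.
move=> UU Uoo eps0; elim: k a f => [|k IH] a f fM lf.
  exists 0%N; split=> //.
    by move=> b f' _ cff'; exact: (cff' [::] [::]).
  by exists [::]; split=> //=; rewrite subrr normr0 mul0r addr0.
have near_gt b : \forall n \near U, (b < n)%N.
  by apply: Uoo; exact: nbhs_infty_gt.
pose fn n s := f (n :: s).
pose P n N : Prop :=
  (forall b (f' : seq nat -> dual X), (forall s, `|f' s| <= M) ->
     interlaced_close b k (fn n) f' ->
     szlenk_iter eps N (iter_lim U k (fn n) - iter_lim U k f')) /\
  exists s, [/\ size s = k, path ltn n s &
     `|fn n s - iter_lim U k (fn n)| <= k%:R * eps + N%:R].
have /choice[c cP] n : exists N, (N <= k)%N /\ ((a < n)%N -> P n N).
  have [an|na] := ltnP a n; last by exists 0%N.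
  have [N [Nk N1 N2]] := IH n (fn n) (fun s => fM _)
    (interlaced_lipschitz_cons an lf).
  by exists N.
have [N cN] := ultra_pigeonhole UU (fun n => (cP n).1).
pose F := iter_lim U k.+1 f.
pose F_ n := iter_lim U k (fn n).
have FF : wstar_cvg U F_ F by exact: iter_lim_cvg fM.
(* Subtrees at n < m differ by at most 1 at the root, as all of the
   derivatives are inside the ball; then m goes to infinity along U. *)
have step1 n : (a < n)%N -> `|F_ n - F| <= 1.
  move=> an; have nFF : wstar_cvg U (fun m => F_ n - F_ m) (F_ n - F).
    apply: (@wstar_cvgB U (fun=> F_ n) F_ (F_ n) F) => //.
    exact: wstar_cvg_cst.
  apply: (wstar_cvg_norm_le _ nFF) => //.
  apply: filterS (near_gt n) => m nm.
  have [_ /(_ an) [H _]] := cP n.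
  have := H m (fn m) (fun s => fM _)
    (interlaced_close_cons an nm (interlaced_lipschitz_close lf)).
  exact: (szlenk_iter_sub (leq0n _)).
have good : \forall n \near U, (a < n)%N /\ P n N.
  by apply: filterS2 (near_gt a) cN => n an <-; split=> //; exact: (cP n).2.
have branch e : (\forall n \near U, `|F_ n - F| <= e) -> exists s,
    [/\ size s = k.+1, path ltn a s & `|f s - F| <= e + (k%:R * eps + N%:R)].
  move=> he; have [n [[an [_ [s [sk ns fs]]]] hen]] := filter_meets _ good he.
  exists (n :: s); split; rewrite /= ?sk ?an//.
  by rewrite -(subrKA (F_ n)) addrC (le_trans (ler_normD _ _))// lerD.
have tree b f' : (forall s, `|f' s| <= M) -> interlaced_close b k.+1 f f' ->
    \forall n \near U, szlenk_iter eps N (F_ n - iter_lim U k.+1 f').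
  move=> f'M cff'; apply: filterS2 good (near_gt b) => n [an [Pn _]] bn.
  have nF' : wstar_cvg U (fun m => F_ n - iter_lim U k (fun s => f' (m :: s)))
      (F_ n - iter_lim U k.+1 f').
    apply: (@wstar_cvgB U (fun=> F_ n)) => //; first exact: wstar_cvg_cst.
    exact: iter_lim_cvg f'M.
  apply: (@wstar_closed_iter U eps N _ _ _ nF').
  apply: filterS (near_gt n) => m nm.
  by apply: (Pn m) => //; exact: interlaced_close_cons nm cff'.
have cvgF d : wstar_cvg U (fun n => F_ n - d) (F - d).
  by apply: (@wstar_cvgB U F_ (fun=> d)) => //; exact: wstar_cvg_cst.
have [big|small] := in_ultra_setVsetC [set n | eps <= `|F_ n - F|] UU.
  exists N.+1; split.
  - by have /filter_ex[n <-] := cN; exact: (cP n).1.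
  - move=> b f' f'M cff'.
    apply: (szlenk_deriv_lim _ (cvgF _) (tree _ _ f'M cff')).
      exact: (@wstar_closed_iter U eps N).
    by apply: filterS big => n; rewrite opprB subrKA.
  - have [|s [sk sa fs]] := branch 1.
      by apply: filterS (near_gt a) => n; exact: step1.
    exists s; split=> //; apply: le_trans fs _.
    rewrite addrCA lerD ?ler_wpM2r ?ler_nat//.
    by rewrite -[leRHS]natr1 addrC.
exists N; split.
- by have /filter_ex[n <-] := cN; exact: leqW (cP n).1.
- move=> b f' f'M cff'; apply: (@wstar_closed_iter U eps N _ _ _ (cvgF _)).
  exact: tree f'M cff'.
- have [|s [sk sa fs]] := branch eps.
    by apply: filterS small => n /= /negP; rewrite -ltNge => /ltW.
  by exists s; split=> //; rewrite -natr1 mulrDl mul1r [_ + eps]addrC -addrA.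
Qed.

(** Comparing f with itself, the difference at the root is 0; that 0 is outside
    the r-th derivative bounds the number of large increments by r. Both s and
    t are close to the same limit f_0, and t can be chosen to the right of s. *)
Lemma interlaced_concentration (eps : R) r k a (f : seq nat -> dual X) (M : R) :
  0 <= eps -> ~ szlenk_iter eps r 0 -> (forall s, `|f s| <= M) ->
  interlaced_lipschitz a k f ->
  exists s t, [/\ size s = k, size t = k, path ltn a (s ++ t) &
    `|f s - f t| <= 2 * (k%:R * eps + r%:R)].
Proof.
move=> eps0 r0 fM lf.
have [U [UU Uoo]] := ultraFilterLemma eventually_filter.
have far b : (a <= b)%N -> exists s, [/\ size s = k, path ltn b s &
    `|f s - iter_lim U k f| <= k%:R * eps + r%:R].
  move=> ab.
  have lfb : interlaced_lipschitz b k f.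
    by move=> p s t st pk H; apply: lf => //; exact: path_ltn_weaken H.
  have [N [_ N1 [s [sk bs fs]]]] := iter_lim_branch UU Uoo eps0 fM lfb.
  exists s; split=> //; apply: le_trans fs _; rewrite lerD2l ler_nat leqNgt.
  apply/negP => rN; apply: r0; apply: (szlenk_iter_sub (ltnW rN)).
  by have := N1 b f fM (interlaced_lipschitz_close lfb); rewrite subrr.
have [s [sk sa fs]] := far a (leqnn _).
have aS : (a <= last a s)%N.
  case: s {sk fs} sa => // n s /(order_path_min ltn_trans)/allP as_.
  by apply/ltnW/as_; rewrite /= mem_last.
have [t [tk st ft]] := far _ aS.
exists s, t; split; rewrite ?cat_path ?sa//.
rewrite -(subrKA (iter_lim U k f)) (le_trans (ler_normD _ _))//.
by rewrite mulr_natl mulr2n lerD// distrC.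
Qed.
End WeakStar.

(** * The Szlenk index *)

Lemma Sz_le_omega (R : realType) (X : normedModType R) (eps : R) :
  ole_ext (Sz X) (Some omega) -> 0 < eps ->
  exists r, ~ szlenk_iter (X := X) eps r 0.
Proof.
move=> Xo eps0.
have := osup_ext_ub (fun e : {e : R | 0 < e} => Sz_eps X (val e))
  (exist _ eps eps0).
rewrite -/(Sz X) /=; case E : (Sz X) Xo => [a|//] /= ao.
have := least_ordP
  (fun a => oiter (szlenk_deriv eps) (@dual_ball R X) a = set0).
rewrite -/(Sz_eps X eps); case: (Sz_eps X eps) => //= b [b0 _] ba.
apply: contrapT => nr.
have ssub := @szlenk_deriv_sub R X eps.
suff : oiter (szlenk_deriv eps) (@dual_ball R X) b 0 by rewrite b0.
apply: (oiter_decr ssub (ole_trans ba ao)).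
rewrite (oiter_limit _ ssub omega_limit) => c [n cn].
apply: (oiter_decr ssub cn); rewrite szlenk_iter_oiter.
by apply: contrapT => nn; apply: nr; exists n.+1.
Qed.

Theorem theorem4p3 (R : realType) (X : completeNormedModType R) :
  equi_coarse_lipschitz_embeds
    (fun k : {k : nat | (0 < k)%N} => interlaced_graph R (val k)) (dual X) ->
  olt_ext (Some omega) (Sz X).
Proof.
case=> A [B [C [D [f [[A0 B0 C0 D0] fAB]]]]].
suff H : ~ ole_ext (Sz X) (Some omega).
  by case: (Sz X) H => //= a; have [|] := ole_or_olt a omega.
move=> Xo; pose L := B + D; have L0 : 0 < L by exact: addr_gt0.
(* The final estimate is A k - C <= 2 L (k eps + r), where L is the Lipschitz
   constant on edges: this eps makes the right side A k / 2 + 2 L r, and k is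
   then taken larger than (2 C + 4 L r) / A. *)
pose eps := A / (4 * L); have eps0 : 0 < eps by rewrite divr_gt0// mulr_gt0.
have [r nr] := Sz_le_omega Xo eps0.
pose k := (Num.bound ((2 * C + 4 * L * r%:R) / A)).+1.
pose F := f (exist _ k (ltn0Sn _)).
have FAB (x y : interlaced_graph R k) :
  A * mdist x y - C <= `|F x - F y| <= B * mdist x y + D.
  exact: fAB (exist _ k (ltn0Sn _)) x y.
have FL (x y : interlaced_graph R k) : mdist x y <= 1 -> `|F x - F y| <= L.
  move=> xy; have /andP[_ /le_trans->//] := FAB x y.
  by rewrite lerD2r ler_piMr// ltW.
(* Entries larger than k put the list to the right of [vertex0], which is
   1, .., k; so F is bounded on these vertices. *)
pose ok s := (size s == k) && path ltn k s.
pose g s := L^-1 *: F (if ok s then vertex s else vertex0).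
have gdist s t : ok s -> ok t ->
    `|g s - g t| = L^-1 * `|F (vertex s) - F (vertex t)|.
  by move=> oks okt; rewrite /g oks okt -scalerBr normrZ gtr0_norm// invr_gt0.
have g_bounded s : `|g s| <= L^-1 * (k%:R * L + `|F vertex0|).
  rewrite normrZ gtr0_norm ?invr_gt0// ler_pM2l ?invr_gt0//.
  case: ifP => [/andP[/eqP sk ks]|_]; last first.
    by rewrite lerDr mulr_ge0// ltW.
  rewrite -[F (vertex s)](subrK (F vertex0)) (le_trans (ler_normD _ _))//.
  rewrite lerD2r distrC vertex0E; apply: lipschitz_far => //.
    by rewrite size_iota.
  rewrite cat_path; apply/andP; split; first exact: (iota_ltn_sorted 0 k.+1).
  by rewrite -nth_last size_iota nth_iota.
have g_lip : interlaced_lipschitz k k g.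
  move=> p s t st pk H; have [kps kpt] := path_ltn_cat_interleave st H.
  rewrite gdist; last 2 first.
  - by rewrite /ok size_cat pk eqxx.
  - by rewrite /ok size_cat -st pk eqxx.
  rewrite ler_pdivrMl// mulr1; apply: FL.
  exact: mdist_cat_interleave H.
have [s [t [sk tk kst gst]]] :=
  interlaced_concentration (ltW eps0) nr g_bounded g_lip.
have oks : ok s by move: kst; rewrite /ok sk eqxx cat_path => /andP[].
have okt : ok t.
  by rewrite /ok tk eqxx; exact: (subseq_path ltn_trans (suffix_subseq s t)).
move: gst; rewrite gdist// ler_pdivrMl// => gst.
have /andP[/le_trans/(_ gst) + _] := FAB (vertex s) (vertex t).
have st0 : path ltn 0 (s ++ t) by exact: path_ltn_weaken (leq0n _) kst.
have dk := mdist_far (R := R) sk tk st0.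
apply/negP; rewrite -ltNge.
apply: (@lt_le_trans _ _ (A * k%:R - C)); last first.
  by rewrite lerD2r ler_pM2l.
have Leps : L * eps = A / 4 by rewrite /eps; field; rewrite gt_eqF.
have kbig : 2 * C + 4 * L * r%:R < A * k%:R.
  rewrite -ltr_pdivrMl// mulrC; apply: lt_trans (archi_boundP _) _.
    apply: divr_ge0 (ltW A0).
    by rewrite addr_ge0 ?mulr_ge0 ?ler0n ?(ltW C0) ?(ltW L0).
  by rewrite ltr_nat.
rewrite (_ : L * _ = 2 * (k%:R * (L * eps) + L * r%:R)); last by ring.
by rewrite Leps; lra.
Qed.
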